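(* Let $t\in\mathbb{R}$ and $(a,b)\in\mathbb{H}_t$. The operator $M_{(a,b)}$ is a projection in $\mathcal{M}_t$ (i.e. $M_{(a,b)}^{*}=M_{(a,b)}=M_{(a,b)}^2$) if and only if either $(a,b)=(1,0)$ or $(a,b)=(0,0)$ in $\mathbb{H}_t$.
   Context: For $t\in\mathbb{R}$, the $t$-scaled hypercomplex ring $\mathbb{H}_t$ is the set $\mathbb{C}^2$ with the usual vector addition and the multiplication $(a_1,b_1)\cdot_t(a_2,b_2)=(a_1a_2+t\,b_1\overline{b_2},\;a_1b_2+b_1\overline{a_2})$, regarded also as a vector space over $\mathbb{R}$; $(a,b)^{\dagger}=(\overline{a},-b)$. For $\eta\in\mathbb{H}_t$, $M_\eta:\mathbb{H}_t\to\mathbb{H}_t$ is the $\mathbb{R}$-linear multiplication operator $M_\eta(h)=\eta\cdot_t h$. The hypercomplex algebra over $\mathbb{R}$ is $\mathcal{M}_t=\{M_\eta:\eta\in\mathbb{H}_t\}$, with operator addition and composition and with adjoint $M_\eta^{*}=M_{\eta^{\dagger}}$. *)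

(* Defs.v *)
From HB Require Import structures.
From mathcomp Require Import all_boot all_order all_algebra all_field.
From mathcomp Require Import complex ring.
From mathcomp Require Import classical_sets reals.

Set Implicit Arguments.
Unset Strict Implicit.
Unset Printing Implicit Defensive.

Import Order.TTheory GRing.Theory Num.Theory.

Local Open Scope ring_scope.

(* An alias of the product, indexed by the scale t, so that it carries the
   scaled multiplication rather than the componentwise product of pairs. *)
Definition hyper (R : realType) (t : R) : Type := (R[i] * R[i])%type.

Section Hypercomplex.
Variables (R : realType) (t : R).
Local Notation H := (hyper t).

HB.instance Definition _ := GRing.Zmodule.copy H (R[i] * R[i])%type.

Definition hmul (x y : H) : H :=
  (x.1 * y.1 + t%:C%C * (x.2 * conjc y.2), x.1 * y.2 + x.2 * conjc y.1).

Definition hone : H := (1, 0).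

Definition hscale (r : R) (x : H) : H := (r%:C%C * x.1, r%:C%C * x.2).

Definition dagger (x : H) : H := (conjc x.1, - x.2).

Fact conjc_real (r : R) : conjc (r%:C%C) = r%:C%C.
Proof. by rewrite /real_complex_def /= oppr0. Qed.

Fact conjcM (x y : R[i]) : conjc (x * y) = conjc x * conjc y.
Proof. exact: rmorphM. Qed.

Fact conjcD (x y : R[i]) : conjc (x + y) = conjc x + conjc y.
Proof. exact: rmorphD. Qed.

Fact hyperD (x y : H) : x + y = (x.1 + y.1, x.2 + y.2).
Proof. by []. Qed.

Fact hmulA : associative hmul.
Proof.
move=> [a1 b1] [a2 b2] [a3 b3]; rewrite /hmul /=.
by rewrite !(conjcD, conjcM) !conjc_real !conjcK; congr (_, _); ring.
Qed.

Fact hmul1x : left_id hone hmul.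
Proof. by move=> [a b]; rewrite /hmul /=; congr (_, _); ring. Qed.

Fact hmulx1 : right_id hone hmul.
Proof.
have conj0 : conjc (0 : R[i]) = 0 by exact: rmorph0.
have conj1 : conjc (1 : R[i]) = 1 by exact: rmorph1.
by move=> [a b]; rewrite /hmul [hone.1]/= [hone.2]/= conj0 conj1;
   congr (_, _); rewrite /=; ring.
Qed.

Fact hmulDl : left_distributive hmul +%R.
Proof.
move=> [a1 b1] [a2 b2] [a3 b3].
by rewrite !hyperD /hmul /=; congr (_, _); ring.
Qed.

Fact hmulDr : right_distributive hmul +%R.
Proof.
move=> [a1 b1] [a2 b2] [a3 b3].
by rewrite !hyperD /hmul /= !conjcD; congr (_, _); ring.
Qed.

Fact hone_neq0 : hone != 0 :> H.
Proof. by apply/eqP => -[] /eqP; rewrite oner_eq0. Qed.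

HB.instance Definition _ := GRing.Zmodule_isNzRing.Build H
  hmulA hmul1x hmulx1 hmulDl hmulDr hone_neq0.

Fact hscaleA (r s : R) (x : H) : hscale r (hscale s x) = hscale (r * s) x.
Proof. by rewrite /hscale /= rmorphM !mulrA. Qed.

Fact hscale1 : left_id 1 hscale.
Proof. by case=> a b; rewrite /hscale /= rmorph1 !mul1r. Qed.

Fact hscaleDr : right_distributive hscale +%R.
Proof. by move=> r x y; rewrite !hyperD /hscale /= !mulrDr. Qed.

Fact hscaleDl (x : H) : {morph hscale^~ x : r s / r + s}.
Proof. by move=> r s; rewrite hyperD /hscale /= rmorphD !mulrDl. Qed.

HB.instance Definition _ := GRing.Zmodule_isLmodule.Build R H
  hscaleA hscale1 hscaleDr hscaleDl.

Fact hscaleAl (r : R) (x y : H) : r *: (x * y) = (r *: x) * y.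
Proof.
case: x y => [a1 b1] [a2 b2].
change (hscale r (hmul (a1, b1) (a2, b2)) = hmul (hscale r (a1, b1)) (a2, b2)).
by rewrite /hscale /hmul /=; congr (_, _); ring.
Qed.

HB.instance Definition _ := GRing.Lmodule_isLalgebra.Build R H hscaleAl.

Fact hscaleAr (r : R) (x y : H) : r *: (x * y) = x * (r *: y).
Proof.
case: x y => [a1 b1] [a2 b2].
change (hscale r (hmul (a1, b1) (a2, b2)) = hmul (a1, b1) (hscale r (a2, b2))).
rewrite /hscale /hmul; cbn [fst snd].
by rewrite !conjcM !conjc_real; congr (_, _); ring.
Qed.

HB.instance Definition _ := GRing.Lalgebra_isAlgebra.Build R H hscaleAr.

Fact hyper_vect_iso : Vector.axiom 4 H.
Proof.
pose f (x : H) : 'rV[R]_4 :=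
  \row_i [:: complex.Re x.1; complex.Im x.1;
             complex.Re x.2; complex.Im x.2]`_i.
pose g (v : 'rV[R]_4) : H :=
  (Complex (v 0 (inord 0)) (v 0 (inord 1)),
   Complex (v 0 (inord 2)) (v 0 (inord 3))).
exists f.
  move=> r [[a1 a2] [b1 b2]] [[c1 c2] [d1 d2]].
  apply/rowP => i; rewrite !mxE.
  by case: i => [[|[|[|[|]]]]] //= _; ring.
exists g.
  by move=> [[a1 a2] [b1 b2]]; rewrite /g /f !mxE !inordK.
move=> v; apply/rowP => i; rewrite mxE.
by case: i => [[|[|[|[|]]]]] //= lt_i; congr (v 0 _); apply/val_inj;
   rewrite /= inordK.
Qed.

HB.instance Definition _ := Lmodule_hasFinDim.Build R H hyper_vect_iso.

HB.instance Definition _ := Algebra_isFalgebra.Build R H.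

Definition mulop (x : H) : 'End(H) := amull x.

Definition hyperalg : set 'End(H) := range mulop.

(* The index x of an operator mulop x is unique (mulop_inj), so the choice is
   immaterial; the value is meaningless on operators outside hyperalg. *)
Definition symbol (T : 'End(H)) : H := xget 0 [set x | mulop x = T].

Definition adjoint (T : 'End(H)) : 'End(H) := mulop (dagger (symbol T)).

Definition is_projection (T : 'End(H)) : Prop :=
  [/\ hyperalg T, adjoint T = T & T = (T \o T)%VF].

Lemma mulopE (a b c d : R[i]) :
  mulop (a, b) (c, d) =
  (a * c + t%:C%C * (b * conjc d), a * d + b * conjc c) :> H.
Proof. by rewrite lfunE. Qed.

Lemma mulop_inj : injective mulop.
Proof. exact: amull_inj. Qed.

Lemma mulopK : cancel mulop symbol.
Proof.
by move=> x; rewrite /symbol; case: xgetP => [y _ /mulop_inj //|/(_ x)]; case.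
Qed.

Lemma adjoint_mulop (x : H) : adjoint (mulop x) = mulop (dagger x).
Proof. by rewrite /adjoint mulopK. Qed.

Lemma hyperalg_linear (r : R) (S T : 'End(H)) :
  hyperalg S -> hyperalg T -> hyperalg (r *: S + T).
Proof.
by move=> [x _ <-] [y _ <-]; exists (r *: x + y) => //; exact: linearP.
Qed.

Lemma hyperalg_comp (S T : 'End(H)) :
  hyperalg S -> hyperalg T -> hyperalg (S \o T)%VF.
Proof. by move=> [x _ <-] [y _ <-]; exists (x * y) => //; exact: amullM. Qed.

Lemma hyperalg_adjoint (T : 'End(H)) : hyperalg (adjoint T).
Proof. by exists (dagger (symbol T)). Qed.

End Hypercomplex.

Arguments mulop {R} t x.
Arguments hyperalg {R} t.

(* Main.v *)
Require Import Defs.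
From mathcomp Require Import all_boot all_order all_algebra all_field.
From mathcomp Require Import complex.
From mathcomp Require Import reals.

(** Since a multiplication operator determines its symbol ([mulop_inj]) and
symbols turn composition and adjoint into the product and [dagger], the
operator of [x] is a projection exactly when [x] is an idempotent fixed by
[dagger] ([is_projection_mulop]).  Invariance under [dagger] already forces
[b = - b], hence [b = 0]: the term carrying the scale [t] vanishes from the
square, and idempotency becomes [a * a = a] in the field of complex numbers,
whose only solutions are 0 and 1.  This is why the answer is the same for
every [t], even where the algebra has nontrivial idempotents. *)

Set Implicit Arguments.
Unset Strict Implicit.
Unset Printing Implicit Defensive.

Import GRing.Theory Num.Theory.

Local Open Scope ring_scope.

Lemma is_projection_mulop (R : realType) (t : R) (x : hyper t) :
  is_projection (mulop t x) <-> dagger x = x /\ x * x = x.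
Proof.
have mulop_sqr : (mulop t x \o mulop t x)%VF = mulop t (x * x).
  by apply/esym; exact: amullM.
rewrite /is_projection adjoint_mulop mulop_sqr; split.
  by case=> _ /mulop_inj xd /mulop_inj xx; split.
by case=> -> ->; split=> //; exists x.
Qed.

(** The second component of [dagger] is [- x.2], and the complex numbers have
characteristic zero. *)
Lemma dagger_fixed_snd (R : realType) (t : R) (x : hyper t) :
  dagger x = x -> x.2 = 0.
Proof. by case: x => x1 x2 [_ /eqP]; rewrite eqNr => /eqP. Qed.

(** The scale [t] only multiplies a product of second components, so it
disappears here. *)
Lemma hyper_sqr_fst (R : realType) (t : R) (a : R[i]) :
  ((a, 0) : hyper t) * ((a, 0) : hyper t) = (a * a, 0).
Proof.
have -> : ((a, 0) : hyper t) * ((a, 0) : hyper t) =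
          hmul ((a, 0) : hyper t) (a, 0) by [].
by rewrite /hmul /= oppr0 !mul0r !mulr0 !addr0.
Qed.

Theorem theorem5p6 (R : realType) (t : R) (a b : R[i]) :
  is_projection (mulop t (a, b)) <->
  (a, b) = (1, 0) :> hyper t \/ (a, b) = (0, 0) :> hyper t.
Proof.
rewrite is_projection_mulop; split.
  case=> /dagger_fixed_snd /= ->; rewrite hyper_sqr_fst => -[/eqP].
  rewrite -subr_eq0 -{3}[a]mulr1 -mulrBr mulf_eq0 subr_eq0.
  by case/orP=> /eqP ->; [right | left].
case=> -[-> ->]; rewrite hyper_sqr_fst ?mulr1 ?mulr0; split=> //.
  by rewrite /dagger /= !oppr0.
by rewrite /dagger /= !oppr0.
Qed.
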